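(* Let $N,d,C\in\mathbb{N}$, let $r\ge 1$ and $0<\delta\le 1$, and let $(\mathbf{x}_1,y_1),\dots,(\mathbf{x}_N,y_N)\in\mathbb{R}^d\times\{1,\dots,C\}$ be a set of $N$ labeled samples with $\|\mathbf{x}_i\|\le r$ for every $i$ and $\|\mathbf{x}_i-\mathbf{x}_j\|\ge\delta$ for every $i\ne j$. Denote $R:=dNCr\delta^{-1}$. Let $B\in\mathbb{N}$ with $1\le B\le\sqrt{N}$. Then there exists a ReLU neural network $F:\mathbb{R}^d\to\mathbb{R}$ with bit complexity $O\left(\frac{B}{\sqrt{\log(B)}}\cdot\log(R)\right)$, depth $O\left(\frac{N\sqrt{\log(B)}}{B}\cdot\log(R)\right)$ and width $O(1)$, such that $F(\mathbf{x}_i)=y_i$ for every $i\in\{1,\dots,N\}$.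
   Context: $\|\cdot\|$ is the Euclidean norm, $\log$ is the base-2 logarithm, and $O(\cdot)$ hides constant factors. $\sigma(z)=\max\{0,z\}$ is the ReLU function, applied coordinatewise to vectors. A ReLU neural network of depth $L$ is a function $\mathcal{N}:\mathbb{R}^d\to\mathbb{R}$ computed by $\mathbf{h}^{(1)}=\sigma(W^{(1)}\mathbf{x}+\mathbf{b}^{(1)})$ with $W^{(1)}\in\mathbb{R}^{m_1\times d}$, $\mathbf{b}^{(1)}\in\mathbb{R}^{m_1}$; $\mathbf{h}^{(i)}=\sigma(W^{(i)}\mathbf{h}^{(i-1)}+\mathbf{b}^{(i)})$ with $W^{(i)}\in\mathbb{R}^{m_i\times m_{i-1}}$, $\mathbf{b}^{(i)}\in\mathbb{R}^{m_i}$ for $i=2,\dots,L-1$; and $\mathcal{N}(\mathbf{x})=W^{(L)}\mathbf{h}^{(L-1)}+\mathbf{b}^{(L)}$ with $W^{(L)}\in\mathbb{R}^{1\times m_{L-1}}$, $\mathbf{b}^{(L)}\in\mathbb{R}$. Its width is $\max\{m_1,\dots,m_{L-1}\}$. The bit complexity of a weight is the number of bits required to represent it (for $n\in\mathbb{N}$ it is $\lceil\log n\rceil$); only weights of finite bit complexity are used. The bit complexity of the network is the maximal bit complexity of its weights.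
   Formalization: N, d, C are taken positive, and log(B), log(R) are read as log(max(2,B)), log(max(2,R)): for B = 1 the stated bounds divide by zero and give depth O(0), and for R = 1 they also vanish; for every B ≥ 2 the bounds are literally those stated. *)

(* Defs.v *)
From HB Require Import structures.
From mathcomp Require Import all_boot all_order all_algebra.
From mathcomp Require Import all_classical all_reals all_analysis.

Set Implicit Arguments.
Unset Strict Implicit.
Unset Printing Implicit Defensive.

Import Order.TTheory GRing.Theory Num.Theory.

Local Open Scope ring_scope.

Definition log2 (R : realType) (z : R) : R := ln z / ln 2.

(* The library norm on 'cV[R]_d is the sup norm, hence this definition. *)
Definition enorm (R : realType) (d : nat) (v : 'cV[R]_d) : R :=
  Num.sqrt (\sum_(i < d) v i 0 ^+ 2).

Definition relu (R : realType) (m : nat) (v : 'cV[R]_m) : 'cV[R]_m :=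
  map_mx (fun z => Num.max 0 z) v.

(* Networks with input dimension n, listed from the input side.
   [Shallow W b V c] is x |-> V relu(W x + b) + c, of depth 2;
   [Deep W b F] puts the hidden layer relu(W x + b) in front of F. *)
Inductive relu_net (R : realType) (n : nat) : Type :=
| Shallow (m : nat) of 'M[R]_(m, n) & 'cV[R]_m & 'rV[R]_m & R
| Deep (m : nat) of 'M[R]_(m, n) & 'cV[R]_m & relu_net R m.

Fixpoint net_eval (R : realType) (n : nat) (F : relu_net R n) :
    'cV[R]_n -> R :=
  match F with
  | Shallow _ W b V c => fun x => (V *m relu (W *m x + b)) 0 0 + c
  | Deep _ W b G => fun x => net_eval G (relu (W *m x + b))
  end.

Fixpoint net_depth (R : realType) (n : nat) (F : relu_net R n) : nat :=
  match F with
  | Shallow _ _ _ _ _ => 2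
  | Deep _ _ _ G => (net_depth G).+1
  end.

Fixpoint net_width (R : realType) (n : nat) (F : relu_net R n) : nat :=
  match F with
  | Shallow m _ _ _ _ => m
  | Deep m _ _ G => maxn m (net_width G)
  end.

(* w can be written with b bits as a signed finite binary expansion
   (-1)^s p / 2^k: s is the sign bit, up_log 2 p is the ceiling of log_2 p,
   and k is the number of bits after the binary point. *)
Definition representable (R : realType) (w : R) (b : nat) : Prop :=
  exists (s : bool) (p k : nat),
    w = (-1) ^+ s * p%:R / 2 ^+ k /\ b = (s + up_log 2 p + k)%N.

(* The least number of bits representing w; it is +oo when w has no finite
   binary expansion. *)
Definition bit_complexity (R : realType) (w : R) : \bar R :=
  ereal_inf [set b%:R%:E | b in [set b : nat | representable w b]].

Definition mx_bits (R : realType) (m n : nat) (A : 'M[R]_(m, n)) : \bar R :=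
  \big[maxe/0%E]_(i < m) \big[maxe/0%E]_(j < n) bit_complexity (A i j).

Fixpoint net_bits (R : realType) (n : nat) (F : relu_net R n) : \bar R :=
  match F with
  | Shallow _ W b V c =>
      maxe (maxe (mx_bits W) (mx_bits b)) (maxe (mx_bits V) (bit_complexity c))
  | Deep _ W b G => maxe (maxe (mx_bits W) (mx_bits b)) (net_bits G)
  end.

Lemma bit_complexity_nat (R : realType) (n : nat) :
  bit_complexity (n%:R : R) = (up_log 2 n)%:R%:E.
Proof.
apply/eqP; rewrite eq_le; apply/andP; split.
  apply: ereal_inf_lbound; exists (up_log 2 n) => //.
  by exists false, n, 0%N; rewrite expr0 mul1r divr1 addn0.
apply: le_ereal_inf_tmp => _ [_ [s [p [k [+ ->]]]] <-].
rewrite lee_fin ler_nat => e.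
suff npk : (n <= 2 ^ (up_log 2 p + k))%N.
  by apply: leq_trans (up_log_min _ npk) _ => //; rewrite -addnA leq_addl.
have k2 : (0 : R) < 2 ^+ k by rewrite exprn_gt0.
have le : (n * 2 ^ k <= p)%N.
  rewrite -(ler_nat R) natrM natrX -ler_pdivlMr // e.
  rewrite ler_pM2r ?invr_gt0 //; case: (s) => /=; rewrite ?expr1 ?expr0 ?mul1r //.
  by rewrite mulN1r (le_trans _ (ler0n _ _)) // oppr_le0.
apply: (leq_trans (leq_pmulr n (expn_gt0 2 k))).
apply: (leq_trans le); apply: (leq_trans (up_logP p (isT : 1 < 2)%N)).
by rewrite leq_pexp2l // leq_addr.
Qed.

(* Main.v *)
Require Import Defs.
From HB Require Import structures.
From mathcomp Require Import all_boot all_order all_algebra.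
From mathcomp Require Import all_classical all_reals all_analysis.
From mathcomp Require Import ring lra zify.

Set Implicit Arguments.
Unset Strict Implicit.
Unset Printing Implicit Defensive.

Import Order.TTheory GRing.Theory Num.Theory.

Local Open Scope ring_scope.

(* A projection with natural weights at most N^2, scaled and shifted, sends the
   samples to points of [0, poly Q] at mutual distance at least 2; it exists
   because each pair of samples is badly separated by at most a fraction
   1 / (N^2 + 1) of the weight vectors.  Cut the sorted points into groups of
   b ~ B / sqrt (log B), and let the code of a group be the natural number that
   concatenates, in O(log Q) bits each, the integer parts and the labels of its
   members.  O(N / b) layers select the code of the group of the input by
   telescoping over the groups; O(b log Q) layers then peel off the bits of the
   code from the top, adding to the output each label whose integer part matches
   the input.  Since b^2 <= N, both phases have depth O(N / b * log Q), and the
   largest weights are the codes, of O(b log Q) bits.  The top bit of an integer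
   u < 2^(e+1) is relu(u - 2^e + 1) - relu(u - 2^e), so integer weights suffice. *)

(** * Bit complexity of integer weights *)

Definition few_bits (R : realType) (n : nat) (w : R) : bool :=
  (bit_complexity w <= n%:R%:E)%E.

(** Up to sign the difference is a natural number at most [2 ^ n]: one bit pays for the sign and [n]
    bits for the magnitude. Differences occur as the weights of a telescoping sum. *)
Lemma few_bits_subn (R : realType) (n p q : nat) :
  (p <= 2 ^ n)%N -> (q <= 2 ^ n)%N -> few_bits n.+1 (p%:R - q%:R : R).
Proof.
move=> pn qn.
have [s [m [mn ->]]] : exists (s : bool) (m : nat),
    (m <= 2 ^ n)%N /\ p%:R - q%:R = (-1) ^+ s * m%:R :> R.
  case: (leqP q p) => qp.
    exists false, (p - q)%N; split; first exact: leq_trans (leq_subr _ _) pn.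
    by rewrite natrB // mul1r.
  exists true, (q - p)%N; split; first exact: leq_trans (leq_subr _ _) qn.
  by rewrite natrB ?(ltnW qp) // mulN1r opprB.
apply: (@le_trans _ _ ((s + up_log 2 m + 0)%N%:R%:E)).
  apply: ereal_inf_lbound; exists (s + up_log 2 m + 0)%N => //.
  by exists s, m, 0%N; rewrite divr1.
rewrite lee_fin ler_nat addn0 -(add1n n).
by apply: leq_add; [exact: leq_b1|exact: up_log_min].
Qed.

Lemma few_bits_nat (R : realType) (n p : nat) :
  (p <= 2 ^ n)%N -> few_bits n.+1 (p%:R : R).
Proof. by move=> pn; have := few_bits_subn R pn (leq0n _); rewrite subr0. Qed.

Lemma few_bits_oppn (R : realType) (n p : nat) :
  (p <= 2 ^ n)%N -> few_bits n.+1 (- p%:R : R).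
Proof. by move=> pn; have := few_bits_subn R (leq0n _) pn; rewrite sub0r. Qed.

Lemma few_bits_opp_pow2 (R : realType) (n e : nat) :
  (e <= n)%N -> few_bits n.+1 (- 2 ^+ e : R).
Proof. by move=> en; rewrite -natrX few_bits_oppn // leq_pexp2l. Qed.

Lemma few_bits0 (R : realType) (n : nat) : few_bits n.+1 (0 : R).
Proof. exact: (@few_bits_nat R n 0). Qed.

Lemma few_bits1 (R : realType) (n : nat) : few_bits n.+1 (1 : R).
Proof. by apply: (@few_bits_nat R n 1); rewrite expn_gt0. Qed.

Lemma few_bitsN1 (R : realType) (n : nat) : few_bits n.+1 (-1 : R).
Proof. by apply: (@few_bits_oppn R n 1); rewrite expn_gt0. Qed.

Definition few_bits01 := (few_bits0, few_bits1, few_bitsN1).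

Lemma mx_bits_le (R : realType) (m p n : nat) (A : 'M[R]_(m, p)) :
  (forall i j, few_bits n (A i j)) -> (mx_bits A <= n%:R%:E)%E.
Proof.
move=> h; have n0 : (0 <= n%:R%:E :> \bar R)%E by rewrite lee_fin.
apply: (big_ind (fun a => a <= n%:R%:E)%E) => // [a b ha hb|i _].
  by rewrite ge_max ha.
apply: (big_ind (fun a => a <= n%:R%:E)%E) => // [a b ha hb|j _].
  by rewrite ge_max ha.
exact: h.
Qed.

(** * Composing networks layer by layer *)

(* Network states are lists of reals and a layer is a list of pairs
   (row of the weight matrix, bias); missing entries stand for 0. *)
Fixpoint dot (R : realType) (c s : seq R) : R :=
  match c, s with
  | a :: c', u :: s' => a * u + dot c' s'
  | _, _ => 0
  end.

Definition layer (R : realType) (rows : seq (seq R * R)) (s : seq R) : seq R :=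
  [seq Num.max 0 (dot p.1 s + p.2) | p <- rows].

Definition admissible (R : realType) (n w : nat) (rows : seq (seq R * R)) :=
  (size rows <= w)%N &&
  all (fun p => [&& (size p.1 <= w)%N, all (few_bits n) p.1 & few_bits n p.2])
    rows.

Definition state (R : realType) (w : nat) (s : seq R) : 'cV[R]_w :=
  \col_i s`_i.

(* L layers turn each input x i into the state s i; a net fed with the states
   therefore extends to a net fed with the inputs. *)
Definition reach (R : realType) (I : Type) (d : nat) (x : I -> 'cV[R]_d)
    (n w L : nat) (s : I -> seq R) : Prop :=
  forall G : relu_net R w,
    (net_bits G <= n%:R%:E)%E -> (net_width G <= w)%N ->
    exists F : relu_net R d,
      [/\ (net_bits F <= n%:R%:E)%E, (net_width F <= w)%N,
          net_depth F = (L + net_depth G)%N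
        & forall i, net_eval F (x i) = net_eval G (state w (s i))].

Lemma dot_sum (R : realType) (w : nat) (c s : seq R) :
  (size c <= w)%N -> dot c s = \sum_(j < w) c`_j * s`_j.
Proof.
elim: c s w => [|a c IH] [|u s] [|w] //= cw; rewrite ?big_ord0 //.
- by rewrite big1 // => i _; rewrite nth_nil mul0r.
- by rewrite big1 // => i _; rewrite nth_nil mul0r.
- by rewrite big1 // => i _; rewrite nth_nil mulr0.
by rewrite big_ord_recl /= (IH _ w).
Qed.

(** Empty rows with zero bias pad the list to a square layer of size [w], which is put in front of
    the net that reads the new state. A padded row outputs 0, as does a missing list entry. *)
Lemma reach_layer (R : realType) (I : Type) (d : nat) (x : I -> 'cV[R]_d)
    (n w L : nat) (rows : seq (seq R * R)) (s s' : I -> seq R) :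
  admissible n.+1 w rows -> (forall i, layer rows (s i) = s' i) ->
  reach x n.+1 w L s -> reach x n.+1 w L.+1 s'.
Proof.
move=> /andP[sz /allP adm] ss' hs G bG wG.
have row_ok (i : nat) : [&& (size (nth ([::], 0%R) rows i).1 <= w)%N,
    all (few_bits n.+1) (nth ([::], 0%R) rows i).1
    & few_bits n.+1 (nth ([::], 0%R) rows i).2].
  case: (ltnP i (size rows)) => h; first by apply/adm/mem_nth.
  by rewrite nth_default //= few_bits0.
pose W : 'M[R]_(w, w) := \matrix_(i, j) ((nth ([::], 0%R) rows i).1)`_j.
pose b : 'cV[R]_w := \col_i (nth ([::], 0%R) rows i).2.
have [|/=|F [bF wF dF eF]] := hs (Deep W b G).
- rewrite /= !ge_max bG andbT; apply/andP; split; apply: mx_bits_le => i j.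
    rewrite mxE; have /and3P[_ /allP h _] := row_ok i.
    case: (ltnP j (size (nth ([::], 0%R) rows i).1)) => hj.
      exact/h/mem_nth.
    by rewrite nth_default // few_bits0.
  by rewrite mxE; have /and3P[] := row_ok i.
- by rewrite geq_max leqnn.
exists F; split=> // [|i]; first by rewrite dF /= addSnnS.
rewrite eF /=; congr (net_eval G _); apply/matrixP => k j.
rewrite !mxE -ss' (_ : \sum__ _ = dot (nth ([::], 0%R) rows k).1 (s i)).
  case: (ltnP k (size rows)) => h; first by rewrite (nth_map ([::], 0%R)).
  by rewrite !nth_default ?size_map //= addr0 maxxx.
have /and3P[h _ _] := row_ok k; rewrite (dot_sum _ h).
by apply: eq_bigr => l _; rewrite !mxE.
Qed.

Lemma reach_ext (R : realType) (I : Type) (d : nat) (x : I -> 'cV[R]_d)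
    (n w L : nat) (s s' : I -> seq R) :
  s =1 s' -> reach x n w L s -> reach x n w L s'.
Proof.
move=> ss' hs G bG wG; have [F [? ? ? h]] := hs G bG wG.
by exists F; split=> // i; rewrite h ss'.
Qed.

(** The last hidden layer copies entry [k] alone, and relu leaves it unchanged because it is
    nonnegative on the inputs. *)
Lemma reach_output (R : realType) (I : Type) (d : nat) (x : I -> 'cV[R]_d)
    (n w L k : nat) (s : I -> seq R) :
  (k < w)%N -> (forall i, 0 <= (s i)`_k) -> reach x n.+1 w L s ->
  exists F : relu_net R d,
    [/\ (net_bits F <= n.+1%:R%:E)%E, (net_width F <= w)%N,
        net_depth F = (L + 2)%N
      & forall i, net_eval F (x i) = (s i)`_k].
Proof.
move=> kw s0 hs.
pose k' := Ordinal kw.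
have [| |F [bF wF dF eF]] :=
    hs (Shallow (delta_mx (0 : 'I_1) k') 0 (const_mx 1) 0).
- rewrite /= !ge_max -andbA; apply/and4P; split; last exact: few_bits0.
  + apply: mx_bits_le => i j; rewrite mxE.
    by case: (_ && _); rewrite few_bits01.
  + by apply: mx_bits_le => i j; rewrite mxE few_bits0.
  + by apply: mx_bits_le => i j; rewrite mxE few_bits1.
- exact: leq_ltn_trans (leq0n k) kw.
exists F; split=> // i; rewrite eF /= addr0 !mxE big_ord1 !mxE mul1r addr0.
rewrite (bigD1 k') //= big1 ?addr0; last first.
  by move=> j jk; rewrite !mxE (negPf jk) mul0r.
by rewrite !mxE !eqxx mul1r max_r.
Qed.

(** * Peeling off binary digits *)

Lemma relu_eq (R : realType) (a v : R) : a = v -> 0 <= v -> Num.max 0 a = v.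
Proof. by move=> -> v0; rewrite max_r. Qed.

Lemma relu_step_ge (R : realType) (u a : R) :
  a <= u -> Num.max 0 (u - a + 1) - Num.max 0 (u - a) = 1.
Proof. by move=> h; rewrite !max_r; lra. Qed.

Lemma relu_step_lt (R : realType) (u a : R) :
  u + 1 <= a -> Num.max 0 (u - a + 1) - Num.max 0 (u - a) = 0.
Proof. by move=> h; rewrite !max_l; lra. Qed.

Lemma relu_step_nat (R : realType) (u a : nat) :
  Num.max 0 (u%:R - a%:R + 1) - Num.max 0 (u%:R - a%:R) = (a <= u)%:R :> R.
Proof.
case: leqP => h; first by apply: relu_step_ge; rewrite ler_nat.
by apply: relu_step_lt; rewrite natr1 ler_nat.
Qed.

(** The two relus of the step at [2 ^ (e + m)] occupy a sixth and a seventh entry, whence the width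
    7. The second layer combines them linearly to strip the top bit and to add it, with place value
    [2 ^ m], to the registers switched on by [a] and [b]. *)
Lemma reach_bit (R : realType) (I : Type) (d : nat) (x : I -> 'cV[R]_d)
    (n L e m : nat) (a b : bool) (z O : I -> R) (U V W : I -> nat) :
  (e + m <= n)%N -> (forall i, 0 <= z i) -> (forall i, 0 <= O i) ->
  (forall i, (U i < 2 ^ (e + m).+1)%N) ->
  reach x n.+1 7 L (fun i => [:: z i; (U i)%:R; O i; (V i)%:R; (W i)%:R]) ->
  reach x n.+1 7 L.+2 (fun i => [:: z i; (U i %% 2 ^ (e + m))%:R; O i;
    (V i + a * (2 ^ m * (2 ^ (e + m) <= U i)))%:R;
    (W i + b * (2 ^ m * (2 ^ (e + m) <= U i)))%:R]).
Proof.
move=> emn z0 O0 UB h.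
set E := (e + m)%N in emn UB *.
have mn : (m <= n)%N by rewrite (leq_trans _ emn) // leq_addl.
have En : (2 ^ E <= 2 ^ n)%N by rewrite leq_pexp2l.
have En1 : ((2 ^ E).-1 <= 2 ^ n)%N by rewrite (leq_trans (leq_pred _)).
have E0 : (0 < 2 ^ E)%N by rewrite expn_gt0.
have am (c : bool) : (c * 2 ^ m <= 2 ^ n)%N.
  by case: c => //; rewrite mul1n leq_pexp2l.
(* The bias [1 - 2 ^ E] is written as the opposite of a natural number, so that [few_bits_oppn]
   bounds its bits. *)
pose rows1 : seq (seq R * R) :=
  [:: ([:: 1], 0); ([:: 0; 1], 0); ([:: 0; 0; 1], 0);
      ([:: 0; 0; 0; 1], 0); ([:: 0; 0; 0; 0; 1], 0);
      ([:: 0; 1], - (2 ^ E).-1%:R); ([:: 0; 1], - (2 ^ E)%:R)].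
pose rows2 : seq (seq R * R) :=
  [:: ([:: 1], 0);
      ([:: 0; 1; 0; 0; 0; - (2 ^ E)%:R; (2 ^ E)%:R], 0);
      ([:: 0; 0; 1], 0);
      ([:: 0; 0; 0; 1; 0; (a * 2 ^ m)%N%:R; - (a * 2 ^ m)%N%:R], 0);
      ([:: 0; 0; 0; 0; 1; (b * 2 ^ m)%N%:R; - (b * 2 ^ m)%N%:R], 0)].
pose p i : R := Num.max 0 ((U i)%:R - (2 ^ E)%:R + 1).
pose q i : R := Num.max 0 ((U i)%:R - (2 ^ E)%:R).
have pq i : p i = q i + (2 ^ E <= U i)%:R.
  by rewrite -relu_step_nat /p /q; ring.
have h1 : reach x n.+1 7 L.+1
    (fun i => [:: z i; (U i)%:R; O i; (V i)%:R; (W i)%:R; p i; q i]).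
  apply: (reach_layer (rows := rows1)) h => [|i].
    by rewrite /admissible /= !few_bits01 !few_bits_oppn.
  rewrite /layer /=.
  congr [:: _; _; _; _; _; _; _]; try by apply: relu_eq => //; ring.
  - rewrite /p -[in RHS](prednK E0) -natr1; congr Num.max; ring.
  - by rewrite /q; congr Num.max; ring.
apply: (reach_layer (rows := rows2)) h1 => [|i].
  by rewrite /admissible /= !few_bits01 !few_bits_oppn ?few_bits_nat.
rewrite /layer /= pq [in RHS]mulnA [in X in (W i + X)%N]mulnA.
have UE : (U i = (2 ^ E <= U i) * 2 ^ E + U i %% 2 ^ E)%N.
  have := UB i; rewrite expnS => UBi; case: leqP => h2.
    rewrite {1}(divn_eq (U i) (2 ^ E)); congr (_ * _ + _)%N.
    apply/eqP; rewrite eqn_leq; apply/andP; split; last by rewrite divn_gt0.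
    by rewrite -ltnS ltn_divLR.
  by rewrite mul0n modn_small.
have {}UE : (U i)%:R = (2 ^ E <= U i)%:R * (2 ^ E)%:R + (U i %% 2 ^ E)%:R :> R.
  by rewrite [in LHS]UE natrD natrM.
congr [:: _; _; _; _; _]; apply: relu_eq => //; rewrite ?UE ?natrD ?natrM; ring.
Qed.

(** Induction from the top bit down, two layers per bit: the quotient by [2 ^ e] is the top bit with
    its place value plus the quotient of the remainder. *)
Lemma reach_digit (R : realType) (I : Type) (d : nat) (x : I -> 'cV[R]_d)
    (n L e m : nat) (a b : bool) (z O : I -> R) (U V W : I -> nat) :
  (e + m <= n)%N -> (forall i, 0 <= z i) -> (forall i, 0 <= O i) ->
  (forall i, (U i < 2 ^ (e + m))%N) ->
  reach x n.+1 7 L (fun i => [:: z i; (U i)%:R; O i; (V i)%:R; (W i)%:R]) ->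
  reach x n.+1 7 (L + m.*2) (fun i => [:: z i; (U i %% 2 ^ e)%:R; O i;
    (V i + a * (U i %/ 2 ^ e))%:R; (W i + b * (U i %/ 2 ^ e))%:R]).
Proof.
elim: m L U V W => [|m IH] L U V W emn z0 O0 UB h.
  rewrite addn0 in UB; rewrite double0 addn0; apply: reach_ext h => i.
  by rewrite modn_small // divn_small // !muln0 !addn0.
rewrite addnS in emn UB; rewrite doubleS -!addSnnS.
have h1 := reach_bit a b (ltnW emn) z0 O0 UB h.
have := IH _ _ _ _ (ltnW emn) z0 O0 _ h1.
move=> /(_ (fun i => ltn_pmod _ (expn_gt0 2 (e + m)))); apply: reach_ext => i.
have Ue : (U i %% 2 ^ (e + m) %% 2 ^ e = U i %% 2 ^ e)%N.
  by rewrite modn_dvdm // dvdn_exp2l // leq_addr.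
have Ud : (U i %/ 2 ^ e = 2 ^ m * (2 ^ (e + m) <= U i)
                          + U i %% 2 ^ (e + m) %/ 2 ^ e)%N.
  have E0 : (0 < 2 ^ (e + m))%N by rewrite expn_gt0.
  have q : (U i %/ 2 ^ (e + m) = (2 ^ (e + m) <= U i))%N.
    case: leqP => h2; last by rewrite divn_small.
    apply/eqP; rewrite eqn_leq divn_gt0 // h2 andbT -ltnS ltn_divLR //.
    by rewrite -expnS.
  rewrite {1}(divn_eq (U i) (2 ^ (e + m))) q.
  by rewrite {2}expnD mulnA mulnAC [(_ * 2 ^ m)%N]mulnC divnMDl ?expn_gt0.
by rewrite Ue Ud !mulnDr !addnA.
Qed.

(** * Gated labels and the decoding of group codes *)

(** The inner relus add up to the distance from [z] to the interval [m, m + 1]. The factor [2 ^ K]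
    lets a distance of at least 1 cancel any label up to [2 ^ K]. *)
Definition gate (R : realType) (K : nat) (z : R) (m y : nat) : R :=
  Num.max 0 (y%:R - 2 ^+ K * (Num.max 0 (m%:R - z) + Num.max 0 (z - m%:R - 1))).

Lemma gate_in (R : realType) (K : nat) (z : R) (m y : nat) :
  m%:R <= z <= m%:R + 1 -> gate K z m y = y%:R.
Proof.
move=> /andP[mz zm]; rewrite /gate [Num.max 0 (m%:R - z)]max_l; last lra.
rewrite [Num.max 0 (z - _ - 1)]max_l; last lra.
by rewrite add0r mulr0 subr0 max_r.
Qed.

Lemma gate_out (R : realType) (K : nat) (z : R) (m y : nat) :
  (y <= 2 ^ K)%N -> z + 1 <= m%:R \/ m%:R + 2 <= z -> gate K z m y = 0.
Proof.
rewrite -(ler_nat R) natrX => yK h; rewrite /gate max_l //.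
have K0 : (0 : R) < 2 ^+ K by rewrite exprn_gt0.
suff : 1 <= Num.max 0 (m%:R - z) + Num.max 0 (z - m%:R - 1) by nra.
have [h1|h1] : 1 <= m%:R - z \/ 1 <= z - m%:R - 1 by case: h; [left|right]; lra.
  by apply: le_trans h1 _; rewrite -[leLHS]addr0 lerD // le_max lexx ?orbT.
by apply: le_trans h1 _; rewrite -[leLHS]add0r lerD // le_max lexx ?orbT.
Qed.

(** One layer computes the two relus of the distance, one the gate, and one adds it to the output
    and clears the registers. *)
Lemma reach_gate (R : realType) (I : Type) (d : nat) (x : I -> 'cV[R]_d)
    (n L K : nat) (z O : I -> R) (U M Y : I -> nat) :
  (K <= n)%N -> (forall i, 0 <= z i) -> (forall i, 0 <= O i) ->
  reach x n.+1 7 L (fun i => [:: z i; (U i)%:R; O i; (M i)%:R; (Y i)%:R]) ->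
  reach x n.+1 7 (L + 3) (fun i =>
    [:: z i; (U i)%:R; O i + gate K (z i) (M i) (Y i); 0; 0]).
Proof.
move=> Kn z0 O0 h; rewrite !addnS addn0.
have h1 : reach x n.+1 7 L.+1 (fun i => [:: z i; (U i)%:R; O i; (Y i)%:R;
    Num.max 0 ((M i)%:R - z i); Num.max 0 (z i - (M i)%:R - 1)]).
  pose rows : seq (seq R * R) :=
    [:: ([:: 1], 0); ([:: 0; 1], 0); ([:: 0; 0; 1], 0);
        ([:: 0; 0; 0; 0; 1], 0); ([:: -1; 0; 0; 1], 0); ([:: 1; 0; 0; -1], -1)].
  apply: (reach_layer (rows := rows)) h => [|i].
    by rewrite /admissible /= !few_bits01.
  rewrite /layer /=; congr [:: _; _; _; _; _; _];
    try (by apply: relu_eq => //; ring); congr Num.max; ring.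
have h2 : reach x n.+1 7 L.+2 (fun i => [:: z i; (U i)%:R; O i;
    gate K (z i) (M i) (Y i)]).
  pose rows : seq (seq R * R) :=
    [:: ([:: 1], 0); ([:: 0; 1], 0); ([:: 0; 0; 1], 0);
        ([:: 0; 0; 0; 1; - 2 ^+ K; - 2 ^+ K], 0)].
  apply: (reach_layer (rows := rows)) h1 => [|i].
    by rewrite /admissible /= !few_bits01 few_bits_opp_pow2.
  rewrite /layer /=; congr [:: _; _; _; _];
    try (by apply: relu_eq => //; ring); congr Num.max; ring.
pose rows : seq (seq R * R) :=
  [:: ([:: 1], 0); ([:: 0; 1], 0); ([:: 0; 0; 1; 1], 0); ([::], 0); ([::], 0)].
apply: (reach_layer (rows := rows)) h2 => [|i].
  by rewrite /admissible /= !few_bits01.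
have g0 : 0 <= gate K (z i) (M i) (Y i) by rewrite le_max lexx.
rewrite /layer /=; congr [:: _; _; _; _; _];
  by apply: relu_eq; rewrite ?addr_ge0 //; ring.
Qed.

(** [f 0] is the least significant digit in base [D], so decoding from the top meets the last member
    first. *)
Definition encode (D : nat) (f : nat -> nat) (t : nat) : nat :=
  (\sum_(s < t) f s * D ^ s)%N.

Lemma encode_lt (D : nat) (f : nat -> nat) (t : nat) :
  (forall s, f s < D)%N -> (encode D f t < D ^ t)%N.
Proof.
move=> fD; elim: t => [|t IH]; first by rewrite /encode big_ord0.
rewrite /encode big_ord_recr /= -/(encode D f t) expnS.
apply: leq_trans (_ : (f t).+1 * D ^ t <= _)%N; last by rewrite leq_mul2r fD orbT.
by rewrite mulSn ltn_add2r.
Qed.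

(** Induction on the number of blocks, for all outputs [O]. The top block costs [2 * K] layers for
    its integer part, [2 * K] for its label and 3 for the gate. *)
Lemma reach_decode (R : realType) (I : Type) (d : nat) (x : I -> 'cV[R]_d)
    (n L K t : nat) (z O : I -> R) (M Y : I -> nat -> nat) :
  ((K + K) * t <= n)%N -> (K <= n)%N ->
  (forall i, 0 <= z i) -> (forall i, 0 <= O i) ->
  (forall i s, M i s < 2 ^ K)%N -> (forall i s, Y i s < 2 ^ K)%N ->
  reach x n.+1 7 L (fun i => [:: z i;
    (encode (2 ^ (K + K)) (fun s => M i s * 2 ^ K + Y i s)%N t)%:R; O i; 0; 0]) ->
  reach x n.+1 7 (L + t * (4 * K + 3)) (fun i => [:: z i; 0;
    O i + \sum_(s < t) gate K (z i) (M i s) (Y i s); 0; 0]).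
Proof.
move=> tn Kn z0 + MK YK; elim: t L O tn => [|t IH] L O tn O0 h.
  rewrite addn0; apply: reach_ext h => i.
  by rewrite /encode !big_ord0 addr0.
set D := (2 ^ (K + K))%N in h IH *.
pose c i s := (M i s * 2 ^ K + Y i s)%N.
have cD i s : (c i s < D)%N.
  apply: leq_trans (_ : (M i s).+1 * 2 ^ K <= _)%N.
    by rewrite /c mulSn addnC ltn_add2r.
  by rewrite /D expnD leq_mul2r MK orbT.
pose T := ((K + K) * t)%N.
have DT : (D ^ t = 2 ^ T)%N by rewrite /D -expnM.
have tnT : (T + K + K <= n)%N by rewrite -addnA addnC -mulnS.
pose r i := encode D (c i) t.
have rlt i : (r i < 2 ^ T)%N by rewrite -DT; apply: encode_lt.
(* The top [K] bits are [M i t], the next [K] bits [Y i t], and the low [T] bits hold the remaining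
   blocks. *)
have eS i : encode D (c i) t.+1
    = (M i t * 2 ^ (T + K) + (Y i t * 2 ^ T + r i))%N.
  rewrite /encode big_ord_recr /= -/(encode D (c i) t) -/(r i) DT.
  by rewrite /c mulnDl -mulnA -expnD [(K + T)%N]addnC addnC addnA.
have ylt i : (Y i t * 2 ^ T + r i < 2 ^ (T + K))%N.
  apply: leq_trans (_ : (Y i t).+1 * 2 ^ T <= _)%N.
    by rewrite mulSn addnC ltn_add2r.
  by rewrite addnC expnD leq_mul2r YK orbT.
have ult i : (encode D (c i) t.+1 < 2 ^ (T + K + K))%N.
  have -> : (T + K + K = (K + K) * t.+1)%N by rewrite mulnS /T; lia.
  by rewrite expnM; apply: encode_lt.
have h1 := @reach_digit R I d x n L (T + K) K true false z O _
  (fun=> 0%N) (fun=> 0%N) tnT z0 O0 ult h.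
have {}h1 : reach x n.+1 7 (L + K.*2)
    (fun i => [:: z i; (Y i t * 2 ^ T + r i)%:R; O i; (M i t)%:R; 0%:R]).
  apply: reach_ext h1 => i; rewrite eS modnMDl divnMDl ?expn_gt0 //.
  by rewrite modn_small // divn_small // !add0n addn0 mul1n.
have TKn : (T + K <= n)%N by apply: leq_trans tnT; rewrite leq_addr.
have h2 := @reach_digit R I d x n _ T K false true z O _
   (fun i => M i t) (fun=> 0%N) TKn z0 O0 ylt h1.
have {}h2 : reach x n.+1 7 (L + K.*2 + K.*2)
    (fun i => [:: z i; (r i)%:R; O i; (M i t)%:R; (Y i t)%:R]).
  apply: reach_ext h2 => i; rewrite modnMDl divnMDl ?expn_gt0 //.
  by rewrite modn_small // divn_small // !add0n !addn0 mul1n.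
have h3 := reach_gate Kn z0 O0 h2.
have := IH _ _ _ _ h3.
have -> : (L + K.*2 + K.*2 + 3 + t * (4 * K + 3) = L + t.+1 * (4 * K + 3))%N.
  by rewrite mulSn !addnA; congr (_ + _)%N; lia.
move=> H; apply: reach_ext (H _ _) => [i||i].
- by rewrite big_ord_recr /= -addrA [X in _ + X]addrC.
- by apply: leq_trans tn; rewrite leq_mul2l leqnSn orbT.
- by rewrite addr_ge0 // le_max lexx.
Qed.

(** * Projection to the line and selection of a code *)

Lemma reach_affine (R : realType) (I : Type) (d : nat) (x : I -> 'cV[R]_d)
    (n w : nat) (c : 'I_d -> nat) (a : nat) (z : I -> R) :
  (forall k, c k <= 2 ^ n)%N -> (a <= 2 ^ n)%N -> (0 < w)%N ->
  (forall i, z i = \sum_k (c k)%:R * x i k 0 + a%:R) -> (forall i, 0 <= z i) ->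
  reach x n.+1 w 1 (fun i => [:: z i]).
Proof.
move=> cn an w0 ez z0 G bG wG.
pose W : 'M[R]_(w, d) := \matrix_(i, k) if i == 0%N :> nat then (c k)%:R else 0.
pose v : 'cV[R]_w := \col_i if i == 0%N :> nat then a%:R else 0.
exists (Deep W v G); split=> //=.
- rewrite !ge_max bG andbT; apply/andP; split; apply: mx_bits_le => i j;
    rewrite mxE; case: ifP => _; by rewrite ?few_bits01 ?few_bits_nat.
- by rewrite geq_max leqnn.
move=> i; congr (net_eval G _); apply/matrixP => k j; rewrite ord1 !mxE.
case: (eqVneq (k : nat) 0%N) => [k0|k0] /=; rewrite ?k0 /=.
  apply: relu_eq => //; rewrite ez; congr (_ + _).
  by apply: eq_bigr => l _; rewrite mxE k0 eqxx.
rewrite addr0 nth_default ?lt0n // big1 ?maxxx // => l _.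
by rewrite mxE (negPf k0) mul0r.
Qed.

(** Passing the threshold [a j] adds the difference of two successive codes to the current one. The
    hypothesis keeps each [z i] out of the open interval (a j - 1, a j), on which the difference of
    the two relus is neither 0 nor 1. *)
Lemma reach_select (R : realType) (I : Type) (d : nat) (x : I -> 'cV[R]_d)
    (n L J : nat) (z : I -> R) (g : I -> nat) (code a : nat -> nat) :
  (forall i, 0 <= z i) ->
  (forall j, code j <= 2 ^ n)%N -> (forall j, a j <= 2 ^ n)%N ->
  (forall i j, (0 < j <= J)%N ->
    if (j <= g i)%N then (a j)%:R <= z i else z i + 1 <= (a j)%:R) ->
  reach x n.+1 7 L (fun i => [:: z i]) ->
  reach x n.+1 7 (L + 1 + 2 * J)
    (fun i => [:: z i; (code (minn J (g i)))%:R]).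
Proof.
move=> z0 codeB aB; elim: J => [|J IH] ha h.
  rewrite muln0 addn0 addn1.
  (* The empty row with bias [code 0] loads the initial code. *)
  apply: (reach_layer (rows := [:: ([:: 1], 0); ([::], (code 0)%:R)])) h => [|i].
    by rewrite /admissible /= !few_bits01 !few_bits_nat.
  rewrite /layer /= min0n.
  by congr [:: _; _]; apply: relu_eq => //; ring.
have {}IH : reach x n.+1 7 (L + 1 + 2 * J)
    (fun i => [:: z i; (code (minn J (g i)))%:R]).
  by apply: IH h => i j /andP[j0 jJ]; apply: ha; rewrite j0 leqW.
have -> : (L + 1 + 2 * J.+1 = (L + 1 + 2 * J).+2)%N by lia.
have aB1 : ((a J.+1).-1 <= 2 ^ n)%N := leq_trans (leq_pred _) (aB _).
pose p i := Num.max 0 (z i - (a J.+1)%:R + 1).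
pose q i := Num.max 0 (z i - (a J.+1)%:R).
have pq i : p i = q i + (J.+1 <= g i)%:R.
  have := ha i J.+1 (leqnn _); case: ifP => _ hz.
    by have := relu_step_ge hz; rewrite -/(p i) -/(q i) /=; lra.
  by have := relu_step_lt hz; rewrite -/(p i) -/(q i) /=; lra.
have h1 : reach x n.+1 7 (L + 1 + 2 * J).+1
    (fun i => [:: z i; (code (minn J (g i)))%:R; p i; q i]).
  pose rows : seq (seq R * R) :=
    [:: ([:: 1], 0); ([:: 0; 1], 0); ([:: 1], 1 - (a J.+1)%:R);
        ([:: 1], - (a J.+1)%:R)].
  apply: (reach_layer (rows := rows)) IH => [|i].
    rewrite /admissible /= !few_bits01 !few_bits_oppn // !andbT.
    by apply: (@few_bits_subn R n 1); rewrite // expn_gt0.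
  rewrite /layer /=; congr [:: _; _; _; _];
    try (by apply: relu_eq => //; ring); congr Num.max; ring.
(* The weights of [p] and [q] are opposite; each is posed as a difference of codes so that
   [few_bits_subn] applies. *)
pose D : R := (code J.+1)%:R - (code J)%:R.
pose D' : R := (code J)%:R - (code J.+1)%:R.
apply: (reach_layer
    (rows := [:: ([:: 1], 0); ([:: 0; 1; D; D'], 0)])) h1 => [|i].
  by rewrite /admissible /= !few_bits01 !few_bits_subn.
rewrite /layer /=; congr [:: _; _]; apply: relu_eq => //; first by ring.
rewrite pq /D /D'; case: (leqP J.+1 (g i)) => h2.
  by rewrite (minn_idPl (ltnW h2)) /=; ring.
by rewrite (minn_idPr (h2 : (g i <= J)%N)) /=; ring.
Qed.

(** * Memorizing sorted points of the line *)

Lemma sorted_memorize (R : realType) (N d : nat) (x : 'I_N -> 'cV[R]_d)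
    (K b L : nat) (z : nat -> R) (y : nat -> nat) :
  (0 < N)%N -> (0 < b)%N -> (forall k, (k < N)%N -> 0 <= z k) ->
  (forall k, (k < N)%N -> z k < 2 ^+ K) ->
  (forall k, k < N -> y k < 2 ^ K)%N ->
  (forall k l, (k < l)%N -> (l < N)%N -> z k + 2 <= z l) ->
  reach x ((K + K) * b).+1 7 L (fun i => [:: z i]) ->
  exists F : relu_net R d,
    [/\ (net_bits F <= ((K + K) * b).+1%:R%:E)%E, (net_width F <= 7)%N,
        net_depth F = (L + 2 * (N.-1 %/ b) + b * (4 * K + 3) + 4)%N
      & forall i, net_eval F (x i) = (y i)%:R].
Proof.
move=> N0 b0 z0 zK yK zz h.
set n := ((K + K) * b)%N in h *.
have Kn : (K <= n)%N by rewrite /n; nia.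
(* Integer parts and labels default to 0 past [N], which fills up an incomplete last group; a label
   0 is gated to 0 whatever its integer part. *)
pose m k := if (k < N)%N then Num.truncn (z k) else 0%N.
pose y' k := if (k < N)%N then y k else 0%N.
have mK k : (m k < 2 ^ K)%N.
  rewrite /m; case: ifP => [kN|_]; last by rewrite expn_gt0.
  by rewrite -(ltr_nat R) natrX (le_lt_trans _ (zK k kN)) // truncn_le z0.
have yK' k : (y' k < 2 ^ K)%N.
  by rewrite /y'; case: ifP => [/yK//|_]; rewrite expn_gt0.
have mz k : (k < N)%N -> (m k)%:R <= z k < (m k)%:R + 1.
  by move=> kN; rewrite /m kN natr1 truncn_itv ?z0.
pose code j := encode (2 ^ (K + K))
  (fun s => m (j * b + s) * 2 ^ K + y' (j * b + s))%N b.
have codeB j : (code j <= 2 ^ n)%N.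
  rewrite /n expnM ltnW // encode_lt // => s.
  apply: leq_trans (_ : (m (j * b + s)).+1 * 2 ^ K <= _)%N.
    by rewrite mulSn addnC ltn_add2r.
  by rewrite expnD leq_mul2r mK orbT.
have mB j : (m (j * b) <= 2 ^ n)%N.
  by apply: leq_trans (ltnW (mK _)) _; rewrite leq_pexp2l.
pose J := (N.-1 %/ b)%N.
have zi0 (i : 'I_N) : 0 <= z i by apply: z0.
have h1 : reach x n.+1 7 (L + 1 + 2 * J)
    (fun i => [:: z i; (code (minn J (i %/ b)))%:R]).
  (* The threshold of group [j] is the integer part of its first point. The gap 2 puts every earlier
     point below [m (j * b) - 1]. *)
  apply: (reach_select (g := fun i : 'I_N => (i %/ b)%N)
    (a := fun j => m (j * b)%N)) h => // i j /andP[j0 jJ].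
  have jN : (j * b < N)%N.
    by rewrite -(prednK N0) ltnS -leq_divRL.
  have /andP[mj1 mj2] := mz _ jN.
  rewrite leq_divRL //; case: leqP => ij.
    apply: le_trans mj1 _; move: ij; rewrite leq_eqVlt => /orP[/eqP->//|ij].
    by have := zz _ _ ij (ltn_ord i); lra.
  by have := zz _ _ ij jN; lra.
have {}h1 : reach x n.+1 7 (L + 1 + 2 * J).+1 (fun i => [:: z i;
    (encode (2 ^ (K + K)) (fun s => m (i %/ b * b + s) * 2 ^ K
       + y' (i %/ b * b + s))%N b)%:R; 0; 0; 0]).
  apply: (reach_layer (rows :=
    [:: ([:: 1], 0); ([:: 0; 1], 0); ([::], 0); ([::], 0); ([::], 0)])) h1 => [|i].
    by rewrite /admissible /= !few_bits01.
  have iJ : (i %/ b <= J)%N by rewrite leq_div2r // -ltnS prednK.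
  rewrite /layer /= (minn_idPr iJ).
  by congr [:: _; _; _; _; _]; apply: relu_eq => //; ring.
have h2 := @reach_decode R _ d x n _ K b (fun i => z i) (fun=> 0)
  (fun i s => m (i %/ b * b + s)%N) (fun i s => y' (i %/ b * b + s)%N)
  (leqnn _) Kn zi0 (fun=> lexx _) (fun i s => mK _) (fun i s => yK' _) h1.
(* Only the term [s = i %% b] survives: the projection of any other sample of the group is at least
   2 away from [z i], so [z i] is at distance at least 1 from its unit interval. *)
have sum_gate (i : 'I_N) : 0 + \sum_(s < b) gate K (z i)
    (m (i %/ b * b + s)%N) (y' (i %/ b * b + s)%N) = (y i)%:R.
  rewrite add0r (bigD1 (Ordinal (ltn_pmod i b0))) //= -divn_eq big1 ?addr0.
    by rewrite /y' ltn_ord gate_in //; have := mz _ (ltn_ord i); lra.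
  move=> s /eqP si; set k := (_ + s)%N.
  have ki : k <> i.
    move=> ki; apply: si; apply: val_inj => /=; rewrite -ki /k.
    by rewrite modnMDl modn_small.
  case: (ltnP k N) => kN; last first.
    rewrite /gate max_l // /y' ltnNge kN /= sub0r oppr_le0 mulr_ge0 //.
    by rewrite addr_ge0 // le_max lexx.
  have /andP[mk1 mk2] := mz k kN.
  apply: gate_out; first exact: ltnW.
  case: (ltngtP k i) => // ki'; [right|left].
    by have := zz _ _ ki' (ltn_ord i); lra.
  by have := zz _ _ ki' kN; lra.
have [||F [bF wF dF eF]] := reach_output (k := 2) _ _ h2 => //.
  by move=> i /=; rewrite sum_gate.
exists F; split=> //; last by move=> i; rewrite eF /= sum_gate.
by rewrite dF /J; lia.
Qed.

(** * Sorting, and integer projections that separate the samples *)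

Lemma sorting_indices (R : realType) (N : nat) (z : 'I_N -> R) (e : R) :
  (0 < N)%N -> 0 < e -> (forall i j, i != j -> e <= `|z i - z j|) ->
  exists p : nat -> 'I_N, (forall i, exists k : 'I_N, p k = i) /\
    forall k l, (k < l)%N -> (l < N)%N -> z (p k) + e <= z (p l).
Proof.
case: N z => // N z _ e0 sep.
pose leT (i j : 'I_N.+1) := z i <= z j.
pose s := sort leT (enum 'I_N.+1).
have ss : sorted leT s by apply: sort_sorted => i j; exact: le_total.
have us : uniq s by rewrite sort_uniq enum_uniq.
have sz : size s = N.+1 by rewrite size_sort size_enum_ord.
exists (nth ord0 s); split=> [i|k l kl lN].
  have si : i \in s by rewrite mem_sort mem_enum.
  have ki : (index i s < N.+1)%N by rewrite -[X in (_ < X)%N]sz index_mem.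
  by exists (Ordinal ki); rewrite nth_index.
have tr : transitive leT by move=> ? ? ?; exact: le_trans.
have kN := ltn_trans kl lN.
have := sorted_ltn_nth tr ord0 ss; rewrite /= sz => /(_ k l kN lN kl) h.
have /sep : nth ord0 s l != nth ord0 s k.
  by rewrite nth_uniq ?sz // gtn_eqF.
by rewrite /leT in h *; rewrite ger0_norm ?subr_ge0 //; lra.
Qed.

Lemma coord_le_enorm (R : realType) (d : nat) (v : 'cV[R]_d) (k : 'I_d) :
  `|v k 0| <= enorm v.
Proof.
rewrite -sqrtr_sqr ler_wsqrtr // (bigD1 k) //= lerDl.
by apply: sumr_ge0 => i _; exact: sqr_ge0.
Qed.

(** Otherwise the squares would sum to less than [d * (e / d) ^ 2], which is at most [e ^ 2]. *)
Lemma enorm_le_coord (R : realType) (d : nat) (v : 'cV[R]_d) (e : R) :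
  0 < e -> e <= enorm v -> exists k, e / d%:R <= `|v k 0|.
Proof.
move=> e0 ev; apply/existsP; apply: contraT; rewrite negb_exists => /forallP h.
case: (posnP d) => [d0|d0].
  move: ev; rewrite /enorm big1 ?sqrtr0 ?leNgt ?e0 // => i.
  by have := ltn_ord i; rewrite [X in (_ < X)%N]d0.
have dR : (0 : R) < d%:R by rewrite ltr0n.
have ed0 : 0 < e / d%:R by rewrite divr_gt0.
have d1 : (1 : R) <= d%:R by rewrite ler1n.
have : e ^+ 2 <= \sum_i v i 0 ^+ 2.
  by rewrite -[leRHS]sqr_sqrtr ?lerXn2r ?nnegrE ?sqrtr_ge0 ?(ltW e0) //;
     apply: sumr_ge0 => i _; exact: sqr_ge0.
apply: contraTT => _; rewrite -ltNge.
apply: lt_le_trans (_ : \sum_(i < d) (e / d%:R) ^+ 2 <= _).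
  apply: ltr_sum => [|i _]; first by apply/hasP; exists (Ordinal d0); rewrite ?mem_index_enum.
  rewrite -[ltLHS]ger0_norm ?sqr_ge0 // normrX.
  by rewrite ltr_pXn2r ?nnegrE ?normr_ge0 ?(ltW ed0) // ltNge h.
rewrite sumr_const card_ord.
have -> : (e / d%:R) ^+ 2 *+ d = e * (e / d%:R).
  by rewrite -[LHS]mulr_natl; field; rewrite gt_eqF.
by rewrite expr2 ler_wpM2l ?(ltW e0) // ler_pdivrMr // ler_peMr ?(ltW e0).
Qed.

(* Two vectors of the set that agree off coordinate k also agree at k, since
   moving that coordinate by 1 moves the sum by at least 2 e. *)
Lemma card_small_sum (R : realType) (d K : nat) (v : 'I_d -> R) (k : 'I_d)
    (e : R) :
  e *+ 2 <= `|v k| ->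
  (#|[set f : {ffun 'I_d -> 'I_K} | (`|\sum_l (f l)%:R * v l| < e)%R]| * K
    <= K ^ d)%N.
Proof.
move=> ev; set A := [set f | _].
(* Overwriting entry [k] of the vectors of [A] by each of the [K] values yields distinct vectors,
   whence the count. *)
pose upd (f : {ffun 'I_d -> 'I_K}) (s : 'I_K) : {ffun 'I_d -> 'I_K} :=
  [ffun l => if l == k then s else f l].
have inj : {in finset.setX A [set: 'I_K]%SET &, injective (fun p => upd p.1 p.2)}.
  move=> [f s] [g t] /= /finset.setXP[fA _] /finset.setXP[gA _] /ffunP fg.
  have st : s = t by have := fg k; rewrite !ffunE eqxx.
  have fgl l : l != k -> f l = g l.
    by move=> lk; have := fg l; rewrite !ffunE (negPf lk).
  congr (_, _) => //; apply/ffunP => l; case: (eqVneq l k) => [->|/fgl//].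
  move: fA gA; rewrite !inE (bigD1 k) //= [in X in _ -> X](bigD1 k) //=.
  rewrite [in X in _ -> X](eq_bigr (fun l => (f l)%:R * v l)); last first.
    by move=> j /fgl->.
  set S := \sum_(_ | _) _ => fA gA; apply/val_inj/eqP; apply: contraT => fgk.
  have : `|((f k)%:R - (g k)%:R) * v k| < e *+ 2.
    have -> : ((f k)%:R - (g k)%:R) * v k
      = ((f k)%:R * v k + S) - ((g k)%:R * v k + S) by ring.
    by apply: le_lt_trans (ler_normB _ _) _; rewrite mulr2n ltrD.
  rewrite normrM => h.
  have : 1 <= `|(f k)%:R - (g k)%:R : R|.
    case: (ltngtP (f k) (g k)) fgk => // c _.
      rewrite distrC ger0_norm ?subr_ge0 ?ler_nat ?(ltnW c) //.
      by rewrite lerBrDr addrC natr1 ler_nat.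
    rewrite ger0_norm ?subr_ge0 ?ler_nat ?(ltnW c) //.
    by rewrite lerBrDr addrC natr1 ler_nat.
  by have := normr_ge0 (v k); nra.
have := card_in_imset inj; rewrite cardsX finset.cardsT card_ord => <-.
by rewrite -[X in (_ <= X ^ _)%N](card_ord K) -[X in (_ <= _ ^ X)%N](card_ord d)
  -card_ffun max_card.
Qed.

Lemma separating_weights (R : realType) (N d : nat) (x : 'I_N -> 'cV[R]_d)
    (delta : R) :
  (0 < d)%N -> 0 < delta ->
  (forall i j, i != j -> delta <= enorm (x i - x j)) ->
  exists w : 'I_d -> nat, (forall k, w k <= N ^ 2)%N /\
    forall i j, i != j ->
      delta / (2 * d%:R) <= `|\sum_k (w k)%:R * (x i k 0 - x j k 0)|.
Proof.
move=> d0 delta0 sep.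
(* [K] exceeds the number of pairs, so the union bound leaves a good vector. The half in [e] makes
   [e *+ 2] the bound [delta / d] on the largest coordinate of a difference. *)
pose K := (N ^ 2).+1.
pose e : R := delta / (2 * d%:R).
pose bad (p : 'I_N * 'I_N) := [set f : {ffun 'I_d -> 'I_K} |
  `|\sum_k (f k)%:R * (x p.1 k 0 - x p.2 k 0)| < e].
have cbad p : p.1 != p.2 -> (#|bad p| * K <= K ^ d)%N.
  case: p => i j /= /sep /(enorm_le_coord delta0)[k hk].
  apply: (@card_small_sum R d K _ k); apply: le_trans (_ : delta / d%:R <= _).
    suff -> : e *+ 2 = delta / d%:R by [].
    by rewrite /e mulr2n; field; rewrite pnatr_eq0 -lt0n.
  by move: hk; rewrite !mxE.
pose U := \bigcup_(p | p.1 != p.2) bad p.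
have cU : (#|U| < K ^ d)%N.
  have K0 : (0 < K)%N by [].
  rewrite -(ltn_pmul2r K0).
  apply: leq_ltn_trans (_ : N ^ 2 * K ^ d < _)%N; last first.
    by rewrite mulnC ltn_pmul2l ?expn_gt0.
  apply: leq_trans (_ : \sum_(p : 'I_N * 'I_N | p.1 != p.2) #|bad p| * K <= _)%N.
    rewrite -big_distrl leq_mul2r; apply/orP; right.
    apply: (big_ind2 (fun (A : {set {ffun 'I_d -> 'I_K}}) n => #|A| <= n)%N).
    - by rewrite cards0.
    - move=> A n B m An Bm; apply: leq_trans (leq_add An Bm).
      exact: leq_card_setU.
    - by [].
  apply: leq_trans (_ : \sum_(p : 'I_N * 'I_N | p.1 != p.2) K ^ d <= _)%N.
    exact: leq_sum.
  rewrite sum_nat_const leq_mul2r; apply/orP; right.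
  by apply: leq_trans (max_card _) _; rewrite card_prod card_ord.
have [f fU] : exists f : {ffun 'I_d -> 'I_K}, f \notin U.
  apply/existsP; apply: contraLR cU; rewrite negb_exists => /forallP h.
  have -> : U = [set: {ffun 'I_d -> 'I_K}].
    by apply/setP => f; rewrite inE; have := h f; rewrite negbK.
  by rewrite cardsT card_ffun !card_ord ltnn.
exists (fun k => nat_of_ord (f k)); split=> [k|i j ij]; first by rewrite -ltnS.
rewrite leNgt; apply: contra fU => h.
by apply/bigcupP; exists (i, j) => //; rewrite inE.
Qed.

(** Scaling by [4 * 2 ^ k] turns the gap [delta / (2 * d)] into at least 2, because
    [d / delta <= 2 ^ k]. The unscaled sum has absolute value at most
    [N * (d * N * r) <= 2 ^ (2 * k)], so the scaled one is at most the shift [2 ^ (3 * k + 2)] in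
    absolute value. *)
Lemma separating_projection (R : realType) (N d k : nat)
    (x : 'I_N -> 'cV[R]_d) (r delta : R) :
  (0 < d)%N -> 0 < delta -> N%:R <= 2 ^+ k :> R ->
  d%:R * N%:R * r <= 2 ^+ k -> d%:R / delta <= 2 ^+ k ->
  (forall i, enorm (x i) <= r) ->
  (forall i j, i != j -> delta <= enorm (x i - x j)) ->
  exists c : 'I_d -> nat, (forall l, c l <= 2 ^ (3 * k + 2))%N /\
    let z i := \sum_l (c l)%:R * x i l 0 + (2 ^ (3 * k + 2))%:R in
    (forall i, 0 <= z i <= 2 ^+ (3 * k + 3)) /\
    (forall i j, i != j -> 2 <= `|z i - z j|).
Proof.
move=> d0 delta0 NT NrT dT xr sep.
have [w [wN wsep]] := separating_weights d0 delta0 sep.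
have T0 : (0 : R) < 2 ^+ k by rewrite exprn_gt0.
have TE : (2 ^ (3 * k + 2))%:R = 4 * 2 ^+ k * 2 ^+ k * 2 ^+ k :> R.
  by rewrite natrX exprD mulnC exprM; ring.
have d0R : (0 : R) < d%:R by rewrite ltr0n.
have sumE (i : 'I_N) : \sum_l (4 * 2 ^ k * w l)%:R * x i l 0
    = 4 * 2 ^+ k * \sum_l (w l)%:R * x i l 0.
  by rewrite mulr_sumr; apply: eq_bigr => l _; rewrite !natrM natrX mulrA.
exists (fun l => 4 * 2 ^ k * w l)%N; split=> [l|/=].
  rewrite -(ler_nat R) TE !natrM natrX -[leRHS]mulrA ler_wpM2l ?mulr_ge0 //.
  apply: le_trans (_ : (N ^ 2)%:R <= _); first by rewrite ler_nat.
  by rewrite natrX expr2 ler_pM.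
split=> [i|i j ij]; last first.
  rewrite !sumE opprD addrACA subrr addr0 -mulrBr -sumrB.
  under eq_bigr do rewrite -mulrBr.
  rewrite normrM ger0_norm ?mulr_ge0 ?(ltW T0) //.
  have := wsep i j ij; set S := `|_| => hS.
  apply: le_trans (_ : 4 * 2 ^+ k * (delta / (2 * d%:R)) <= _); last first.
    by rewrite ler_wpM2l ?mulr_ge0 ?(ltW T0).
  have -> : 4 * 2 ^+ k * (delta / (2 * d%:R)) = 2 * (2 ^+ k * delta / d%:R).
    by field; rewrite gt_eqF.
  by rewrite ler_peMr // ler_pdivlMr // mul1r -ler_pdivrMr.
have wr : `|\sum_l (w l)%:R * x i l 0| <= 2 ^+ k * 2 ^+ k.
  apply: le_trans (ler_norm_sum _ _ _) _.
  apply: le_trans (_ : \sum_(l < d) (N ^ 2)%:R * r <= _).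
    apply: ler_sum => l _; rewrite normrM ger0_norm // ler_pM // ?ler_nat //.
    exact: le_trans (coord_le_enorm _ _) (xr i).
  rewrite sumr_const card_ord -[leLHS]mulr_natl natrX.
  have -> : d%:R * (N%:R ^+ 2 * r) = N%:R * (d%:R * N%:R * r) by ring.
  have r0 : 0 <= r by apply: le_trans (xr i); exact: sqrtr_ge0.
  by rewrite ler_pM // !mulr_ge0.
have -> : 2 ^+ (3 * k + 3) = 8 * 2 ^+ k * 2 ^+ k * 2 ^+ k :> R.
  by rewrite exprD mulnC exprM; ring.
rewrite sumE TE; move: wr; set S := \sum_(_ < _) _; rewrite ler_norml.
by move=> /andP[S1 S2]; apply/andP; split; nra.
Qed.

(** * Logarithms, choice of parameters and final count *)

Lemma log2_ge1 (R : realType) (q : R) : 2 <= q -> 1 <= log2 q.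
Proof.
move=> q2; have l2 : 0 < ln (2 : R) by rewrite ln_gt0 // ltr1n.
by rewrite /log2 ler_pdivlMr // mul1r ler_ln ?posrE //; lra.
Qed.

Lemma log2_le_nat (R : realType) (q : R) (k : nat) :
  0 < q -> (log2 q <= k%:R) = (q <= 2 ^+ k).
Proof.
move=> q0; have l2 : 0 < ln (2 : R) by rewrite ln_gt0 // ltr1n.
rewrite /log2 ler_pdivrMr // mulr_natl -lnXn //.
by rewrite ler_ln ?posrE ?exprn_gt0.
Qed.

Lemma pow2_ge (R : realType) (q : R) :
  2 <= q -> exists k : nat, q <= 2 ^+ k /\ k%:R <= 2 * log2 q.
Proof.
move=> q2; have l1 := log2_ge1 q2.
have l0 : 0 <= log2 q by lra.
(* The added 1 is absorbed by the factor 2 since [1 <= log2 q]. *)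
exists (Num.truncn (log2 q)).+1; have /andP[h1 h2] := truncn_itv l0.
by rewrite -log2_le_nat; [rewrite -natr1 in h2 *; split; lra|lra].
Qed.

Theorem theorem6p2 (R : realType) :
  exists c : nat,
    forall (N d C : nat) (r delta : R)
           (x : 'I_N -> 'cV[R]_d) (y : 'I_N -> nat) (B : nat),
      (0 < N)%N -> (0 < d)%N -> (0 < C)%N ->
      1 <= r -> 0 < delta -> delta <= 1 ->
      (forall i : 'I_N, (1 <= y i <= C)%N) ->
      (forall i : 'I_N, enorm (x i) <= r) ->
      (forall i j : 'I_N, i != j -> delta <= enorm (x i - x j)) ->
      (1 <= B)%N -> B%:R <= Num.sqrt (N%:R : R) ->
      let Q : R := d%:R * N%:R * C%:R * r * delta^-1 in
      let logQ : R := log2 (Num.max 2 Q) in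
      let logB : R := log2 (Num.max 2 B%:R) in
      exists F : relu_net R d,
        [/\ (net_bits F <= (c%:R * (B%:R / Num.sqrt logB * logQ))%:E)%E,
            (net_depth F)%:R <= c%:R * (N%:R * Num.sqrt logB / B%:R * logQ),
            (net_width F <= c)%N
          & forall i : 'I_N, net_eval F (x i) = (y i)%:R].
Proof.
have arith (k b : nat) : (0 < b)%N ->
    (3 * k + 2 <= (3 * k + 4 + (3 * k + 4)) * b)%N /\ (k < 3 * k + 4)%N.
  by move=> b0; split; [apply: leq_trans (leq_pmulr _ b0); lia|lia].
(* The depth is [5 + 2 * q + b * (12 * k + 19)] with [q <= 2 * P], [b <= P] and [k <= 2 * l], which
   gives 5 + 4 + 24 + 19 = 52. The bits need only 21 and the width 7. *)
exists 52%N => N d C r delta x y B N0 d0 C0 r1 delta0 delta1 yC xr sep B1 BN.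
move=> Q l lB.
have Q2 : 2 <= Num.max 2 Q by rewrite le_max lexx.
have l1 : 1 <= l := log2_ge1 Q2.
have [k [Qk kl]] := pow2_ge Q2; rewrite -/l in kl.
have {}Qk : Q <= 2 ^+ k by apply: le_trans Qk; rewrite le_max lexx orbT.
pose s := Num.sqrt lB.
have B1R : (1 : R) <= B%:R by rewrite ler1n.
have lB1 : 1 <= lB by apply: log2_ge1; rewrite le_max lexx.
(* This yields [s <= s ^ 2 <= B], so that the real group size [beta] is at least 1. *)
have lBB : lB <= B%:R.
  have m0 : (0 : R) < Num.max 2 B%:R by rewrite lt_max ltr0n.
  rewrite /lB log2_le_nat // ge_max -natrX !ler_nat.
  by rewrite -{1}(expn1 2) leq_pexp2l // ltnW // ltn_expl.
have s1 : 1 <= s by rewrite -sqrtr1 ler_wsqrtr.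
have ss : s ^+ 2 = lB by rewrite sqr_sqrtr //; lra.
have sB : s <= B%:R by nra.
pose beta : R := B%:R / s.
have beta1 : 1 <= beta by rewrite ler_pdivlMr ?mul1r //; lra.
have betaB : beta <= B%:R by rewrite ler_pdivrMr ?ler_peMr //; lra.
pose P : R := N%:R * s / B%:R.
have PE : P * beta = N%:R by rewrite /P /beta; field; lra.
(* Here [B <= sqrt N] enters: the group size is at most the number [P] of groups, so decoding fits
   in the depth bound. *)
have betaP : beta <= P.
  have N0R : (0 : R) <= N%:R by [].
  have : beta ^+ 2 <= N%:R.
    rewrite -(sqr_sqrtr N0R) lerXn2r ?nnegrE ?sqrtr_ge0 //; first lra.
    exact: le_trans BN.
  by rewrite -PE expr2 ler_pM2r //; lra.
pose b := Num.truncn beta.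
have beta0 : 0 <= beta by lra.
have /andP[b_le b_gt] := truncn_itv beta0; rewrite -/b -natr1 in b_le b_gt.
have b0 : (0 < b)%N by rewrite truncn_gt0.
have b1R : (1 : R) <= b%:R by rewrite ler1n.
have di1 : 1 <= delta^-1 by rewrite invf_ge1.
have dR : (1 : R) <= d%:R by rewrite ler1n.
have NR : (1 : R) <= N%:R by rewrite ler1n.
have CR : (1 : R) <= C%:R by rewrite ler1n.
have dN1 : (1 : R) <= d%:R * N%:R by rewrite mulr_ege1.
have dNC1 : (1 : R) <= d%:R * N%:R * C%:R by rewrite mulr_ege1.
have dNCr1 : (1 : R) <= d%:R * N%:R * C%:R * r by rewrite mulr_ege1.
(* All factors of [Q] are at least 1, so each of the products below is at most [Q <= 2 ^ k]. *)
have grow (a u v : R) : 0 <= a -> 1 <= v -> a <= u -> a <= u * v by nra.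
have NT : N%:R <= 2 ^+ k :> R.
  apply: le_trans Qk; rewrite /Q; do 3![apply/grow => //].
  by rewrite ler_peMl.
have CT : C%:R <= 2 ^+ k :> R.
  apply: le_trans Qk; rewrite /Q; do 2![apply/grow => //].
  by rewrite ler_peMl.
have NrT : d%:R * N%:R * r <= 2 ^+ k.
  apply: le_trans Qk; rewrite /Q; apply/grow => //; first by nra.
  by rewrite -[leRHS]mulrA [C%:R * r]mulrC mulrA ler_peMr //; nra.
have dT : d%:R / delta <= 2 ^+ k.
  apply: le_trans Qk; rewrite /Q ler_pM2r ?invr_gt0 //.
  by do 3![apply/grow => //].
have [c [cB]] := separating_projection d0 delta0 NT NrT dT xr sep.
set A := (2 ^ (3 * k + 2))%N; move=> /=.
pose z i := \sum_l (c l)%:R * x i l 0 + A%:R : R. move=> [zB zsep].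
have [p [psurj psep]] := @sorting_indices R N z 2 N0 ltac:(lra) zsep.
(* One more than [3 * k + 3], since projections may equal [2 ^ (3 * k + 3)] and must be strictly
   below [2 ^ K]. *)
pose K := (3 * k + 4)%N; pose n := ((K + K) * b)%N.
have [Kn kK] : (3 * k + 2 <= n)%N /\ (k < K)%N := arith k b b0.
have z0 i : 0 <= z i by have /andP[] := zB i.
(* The samples are renumbered by increasing projection; as [p] is onto, a net correct on [xs] is
   correct on all of them. *)
pose xs (i : 'I_N) := x (p i).
have h : reach xs n.+1 7 1 (fun i : 'I_N => [:: z (p i)]).
  apply: (reach_affine (c := c) (a := A)) => //.
    by move=> j; apply: leq_trans (cB j) _; rewrite leq_pexp2l.
  by rewrite leq_pexp2l.
have [||F [bF wF dF eF]] := @sorted_memorize R N d xs K b 1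
    (fun j => z (p j)) (fun j => y (p j)) N0 b0 (fun j _ => z0 _) _ _ psep h.
- move=> j _; have /andP[_ h2] := zB (p j).
  by apply: le_lt_trans h2 _; rewrite ltr_eXn2l ?ltr1n // ltn_add2l.
- move=> j _; have /andP[_ h2] := yC (p j); apply: leq_ltn_trans h2 _.
  by rewrite -(ltr_nat R) natrX (le_lt_trans CT) // ltr_eXn2l ?ltr1n.
have KE : K%:R = 3 * k%:R + 4 :> R by rewrite /K natrD natrM.
have k0 : (0 : R) <= k%:R by [].
exists F; split.
- apply: le_trans bF _; rewrite lee_fin -/beta -natr1 natrM natrD KE.
  have : b%:R * k%:R <= beta * (2 * l) by rewrite ler_pM.
  have : beta <= beta * l by rewrite ler_peMr.
  nra.
- rewrite -/s -/P dF; set q' := (_ %/ _)%N; pose q : R := q'%:R.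
  have -> : (1 + 2 * q' + b * (4 * K + 3) + 4)%:R
      = 1 + 2 * q + b%:R * (4 * (3 * k%:R + 4) + 3) + 4 :> R.
    by rewrite -KE !(natrD, natrM).
  have qb : q * b%:R <= N%:R.
    rewrite -natrM ler_nat; apply: leq_trans (leq_trunc_div _ _) _.
    exact: leq_pred.
  have q0 : 0 <= q by [].
  (* Rounding [beta] down to [b >= 1] loses less than a factor 2, since [beta < b + 1 <= 2 * b]. *)
  have q2 : q <= 2 * P.
    have : q * beta <= 2 * (P * beta) by nra.
    by rewrite mulrA ler_pM2r //; lra.
  have h1 : b%:R * k%:R <= P * (2 * l) by rewrite ler_pM //; lra.
  have h2 : P <= P * l by rewrite ler_peMr //; lra.
  nra.
- exact: leq_trans wF _.
by move=> i; have [j <-] := psurj i; exact: eF.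
Qed.
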